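(* The Hilbert series of the coordinate ring of the cone of ${\mathrm{Sp}}(4)$ is \[\mathrm{H}(\mathcal{O}(\mathcal{C}({\mathrm{Sp}}(4)));t)=\frac{1+5t+5t^2+t^3}{(1-t)^{11}}.\]
   Context: ${\mathrm{Sp}}(4)=\{M\in\mathbb{C}^{4\times4}\mid M^TJM=J\}$ where $J$ is block diagonal with two blocks $\begin{pmatrix}0&1\\-1&0\end{pmatrix}$. The cone $\mathcal{C}({\mathrm{Sp}}(4))$ is the Zariski closure in $\mathbb{C}^{4\times 4}$ of $\{cM\mid c\in\mathbb{C},M\in{\mathrm{Sp}}(4)\}$; its coordinate ring is the quotient of the standard graded polynomial ring $\mathbb{C}[x_{ij}\mid 1\le i,j\le 4]$ by the homogeneous vanishing ideal, with the induced grading. The Hilbert series of a graded algebra $A=\bigoplus_dA_d$ is $\sum_d\dim_{\mathbb{C}}(A_d)t^d$. *)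

(* Defs.v *)
From HB Require Import structures.
From mathcomp Require Import all_boot all_order all_algebra.
From mathcomp Require Import mpoly.
From mathcomp Require Import complex.
From Stdlib Require Rdefinitions.
From mathcomp Require Import Rstruct.

Set Implicit Arguments.
Unset Strict Implicit.
Unset Printing Implicit Defensive.
Import GRing.Theory.
Local Open Scope ring_scope.

Definition CC : Type := complex Rdefinitions.R.

Definition Jmat : 'M[CC]_4 :=
  \matrix_(i < 4, j < 4)
    (if [|| ((i : nat) == 0%N) && ((j : nat) == 1%N)
          | ((i : nat) == 2%N) && ((j : nat) == 3%N)] then 1
     else if [|| ((i : nat) == 1%N) && ((j : nat) == 0%N)
               | ((i : nat) == 3%N) && ((j : nat) == 2%N)] then -1
     else 0).

Definition Sp4 (M : 'M[CC]_4) : Prop := M^T *m Jmat *m M = Jmat.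

Definition cone_set (N : 'M[CC]_4) : Prop :=
  exists (c : CC) (M : 'M[CC]_4), Sp4 M /\ N = c *: M.

(* Polynomial ring C[x_ij | 1 <= i,j <= 4]: the variable x_ij (0-based i,j)
   is the variable of index 4*i + j of {mpoly CC[16]}. *)
Definition mat_pt (N : 'M[CC]_4) : 'I_16 -> CC :=
  fun k => N (inord (k %/ 4)) (inord (k %% 4)).

Definition peval (p : {mpoly CC[16]}) (N : 'M[CC]_4) : CC := p.@[mat_pt N].

Definition vanishing_ideal (X : 'M[CC]_4 -> Prop) (p : {mpoly CC[16]}) : Prop :=
  forall N, X N -> peval p N = 0.

Definition zariski_closure (X : 'M[CC]_4 -> Prop) (N : 'M[CC]_4) : Prop :=
  forall p, vanishing_ideal X p -> peval p N = 0.

Definition cone_Sp4 : 'M[CC]_4 -> Prop := zariski_closure cone_set.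

(* Homogeneous of degree d (for the standard grading); 0 is homogeneous of
   every degree, so these form the graded piece S_d. *)
Definition homog_deg (d : nat) (p : {mpoly CC[16]}) : bool :=
  all (fun m : 'X_{1..16} => mdeg m == d) (msupp p).

Definition indep_mod (I : {mpoly CC[16]} -> Prop) (k : nat)
    (fs : 'I_k -> {mpoly CC[16]}) : Prop :=
  forall a : 'I_k -> CC, I (\sum_(i < k) a i *: fs i) -> forall i, a i = 0.

Definition graded_dim_eq (I : {mpoly CC[16]} -> Prop) (d n : nat) : Prop :=
  (exists fs : 'I_n -> {mpoly CC[16]},
      (forall i, homog_deg d (fs i)) /\ indep_mod I fs) /\
  (forall fs : 'I_n.+1 -> {mpoly CC[16]},
      (forall i, homog_deg d (fs i)) -> ~ indep_mod I fs).

Definition num_coef (k : nat) : nat := nth 0%N [:: 1; 5; 5; 1]%N k.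

(* Coefficient of t^d in (1+5t+5t^2+t^3)/(1-t)^11, using
   1/(1-t)^11 = sum_j binom(j+10,10) t^j (Cauchy product). *)
Definition series_coef (d : nat) : nat :=
  (\sum_(k < d.+1) num_coef k * 'C(d - k + 10, 10))%N.

(* Main.v *)
Require Import Defs.
From mathcomp Require Import all_boot all_algebra mpoly.
From mathcomp Require Import complex Rstruct zify ring.

(* Write x_k, with k = 4 i + j, for the entry (i, j) of a matrix M.  The
   relations M^T J M = c J and M J M^T = c J yield ten quadrics vanishing on the
   cone (it is the cone over the spinor variety of D5).  Ordered by suitable
   weights, each quadric rewrites one squarefree product x_a x_b, so the
   monomials divisible by none of these ten products, called standard, span
   the coordinate ring.  The chart x_0 = 1 of the cone is parametrized by ten
   free coordinates, the other five being quadratic in them; substituting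
   rapidly growing powers of one indeterminate t for the free coordinates sends
   the standard monomials of degree d to polynomials in t of distinct degrees,
   so these are linearly independent.  Finally the standard monomials are counted
   through a shelling of their simplicial complex, whose h-vector is
   (1, 5, 5, 1). *)

Set Implicit Arguments.
Unset Strict Implicit.
Unset Printing Implicit Defensive.
Import GRing.Theory Num.Theory.

(** * Counting standard monomials *)

Fixpoint exponents (n d : nat) : seq (seq nat) :=
  if n is n'.+1 then
    flatten [seq [seq i :: t | t <- exponents n' (d - i)] | i <- iota 0 d.+1]
  else if d == 0 then [:: [::]] else [::].

Lemma exponentsS n d : exponents n.+1 d =
  flatten [seq [seq i :: t | t <- exponents n (d - i)] | i <- iota 0 d.+1].
Proof. by []. Qed.

Lemma mem_exponents n d s :
  (s \in exponents n d) = (size s == n) && (sumn s == d).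
Proof.
elim: n d s => [|n IHn] d [|i s].
- by case: d.
- by case: d.
- by rewrite exponentsS; apply/negbTE/negP => /flatten_mapP[j _ /mapP[]].
rewrite exponentsS [size _]/= [sumn _]/= eqSS.
apply/flatten_mapP/andP => [[j]|[/eqP sz_s /eqP <-]].
  rewrite mem_iota => /andP[_ lt_jd] /mapP[t]; rewrite IHn => /andP[sz_t /eqP sum_t].
  by case=> -> ->; split=> //; apply/eqP; lia.
exists i; first by rewrite mem_iota; lia.
by apply/map_f; rewrite IHn sz_s eqxx addKn eqxx.
Qed.

Lemma uniq_exponents n d : uniq (exponents n d).
Proof.
elim: n d => [|n IHn] d; first by case: d.
rewrite exponentsS; apply/allpairs_uniq_dep; rewrite ?iota_uniq //.
by move=> [i1 s1] [i2 s2] _ _ /= [-> ->].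
Qed.

Definition obeys (c : option bool) (i : nat) : bool :=
  if c is Some b then (0 < i) == b else true.

Definition npos (c : seq (option bool)) := count (pred1 (Some true)) c.
Definition nfree (c : seq (option bool)) := count (predC1 (Some false)) c.

(** The number of weak compositions of [d] into [n] parts. *)
Definition ncompositions (n d : nat) : nat :=
  if n is n'.+1 then 'C(d + n', n') else (d == 0).

(** In binomial form this is the hockey-stick identity. *)
Lemma sum_ncompositions n d :
  \sum_(0 <= i < d.+1) ncompositions n (d - i) = ncompositions n.+1 d.
Proof.
rewrite big_nat_rev (eq_big_nat _ _ (F2 := ncompositions n)) /=; last first.
  by move=> i Hi; congr ncompositions; lia.
elim: d => [|d IHd].
  by rewrite big_nat1; case: n => [|n]; rewrite /= ?add0n ?binn ?bin0.
rewrite big_nat_recr //= IHd; case: n {IHd} => [|n] /=; first by rewrite !bin0.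
by rewrite addSn !addnS binS addSn.
Qed.

(** Subtracting 1 from each entry forced to be positive leaves an arbitrary weak composition of
    [d - npos c]. Its parts are all entries not forced to vanish, so [nfree] counts the positive
    ones too. *)
Lemma count_exponents c d :
  count (all2 obeys c) (exponents (size c) d) =
  if npos c <= d then ncompositions (nfree c) (d - npos c) else 0.
Proof.
elim: c d => [|a c IHc] d; first by case: d.
rewrite [size _]/= exponentsS count_flatten -map_comp sumnE big_map.
have -> : iota 0 d.+1 = index_iota 0 d.+1 by rewrite /index_iota subn0.
under eq_bigr => i _.
  rewrite /= count_map (eq_count (a2 := fun t => obeys a i && all2 obeys c t)) //.
  rewrite (_ : count _ _ = obeys a i *
    count (all2 obeys c) (exponents (size c) (d - i))); last first.
    by case: (obeys a i); rewrite /= ?mul1n ?mul0n // count_pred0.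
  rewrite IHc; over.
rewrite /npos /nfree /= -/(npos c) -/(nfree c).
set p := npos c; set n := nfree c.
have sum_tail e : \sum_(0 <= i < e.+1)
    (if p <= e - i then ncompositions n (e - i - p) else 0) =
    if p <= e then ncompositions n.+1 (e - p) else 0.
  case: leqP => [le_pe|lt_ep].
    rewrite -sum_ncompositions (big_cat_nat (n := (e - p).+1)) //=; last by lia.
    rewrite [X in _ + X]big1_seq ?addn0; last first.
      by move=> i; rewrite mem_index_iota => /andP[_ Hi]; case: leqP => //; lia.
    apply: eq_big_nat => i Hi; rewrite (_ : p <= e - i); last by lia.
    by congr ncompositions; lia.
  by rewrite big1_seq // => i _; case: leqP => //; lia.
case: a => [[]|] /=.
- rewrite big_nat_recl // mul0n add0n; case: d => [|d]; first by rewrite big_nil.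
  under eq_bigr => i _ do rewrite mul1n subSS.
  by rewrite sum_tail !add1n ltnS subSS add0n.
- by rewrite big_nat_recl // big1 // mul1n subn0 addn0 !add0n.
- by under eq_bigr => i _ do rewrite mul1n; rewrite sum_tail !add0n.
Qed.

(* The left-hand sides of [straightening] below. *)
Definition forbidden_pairs : seq (nat * nat) :=
  [:: (2, 4); (0, 7); (0, 13); (0, 9); (10, 15); (9, 15); (10, 13); (7, 10);
      (4, 13); (2, 7)].

Definition standard (s : seq nat) : bool :=
  all (fun ab => (nth 0 s ab.1 == 0) || (nth 0 s ab.2 == 0)) forbidden_pairs.

(* A shelling of the simplicial complex of standard supports: a facet is given
   by the set of variables it avoids and the set of variables that distinguish
   its faces from those of the earlier facets, so that every standard monomial
   is counted exactly once in [standard_facets]. *)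
Definition facets : seq (seq nat * seq nat) :=
  [:: ([:: 10; 4; 9; 13; 7], [::]); ([:: 15; 4; 9; 13; 7], [:: 10]);
      ([:: 10; 2; 9; 13; 7], [:: 4]); ([:: 15; 2; 9; 13; 7], [:: 10; 4]);
      ([:: 0; 15; 4; 13; 7], [:: 9]); ([:: 0; 15; 2; 13; 7], [:: 4; 9]);
      ([:: 0; 10; 4; 9; 7], [:: 13]); ([:: 0; 15; 10; 4; 7], [:: 9; 13]);
      ([:: 0; 10; 2; 9; 13], [:: 7]); ([:: 0; 15; 10; 2; 13], [:: 9; 7]);
      ([:: 0; 10; 2; 4; 9], [:: 13; 7]); ([:: 0; 15; 10; 2; 4], [:: 9; 13; 7])].

Definition facet_constraint (f : seq nat * seq nat) : seq (option bool) :=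
  mkseq (fun k => if k \in f.1 then Some false
                  else if k \in f.2 then Some true else None) 16.

Lemma seq16P (s : seq nat) : size s = 16 ->
  s = [:: nth 0 s 0; nth 0 s 1; nth 0 s 2; nth 0 s 3; nth 0 s 4; nth 0 s 5;
          nth 0 s 6; nth 0 s 7; nth 0 s 8; nth 0 s 9; nth 0 s 10; nth 0 s 11;
          nth 0 s 12; nth 0 s 13; nth 0 s 14; nth 0 s 15].
Proof. by do 17! [case: s => [|? s] //]. Qed.

Lemma standard_facets s : size s = 16 ->
  standard s = count (fun f => all2 obeys (facet_constraint f) s) facets :> nat.
Proof.
move/seq16P=> ->.
have eq0b n : (n == 0) = ~~ (0 < n) by rewrite lt0n negbK.
rewrite /standard /= !eq0b.
(* Both sides depend only on the positivity of the eight exponents occurring in [forbidden_pairs],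
   which leaves 2^8 Boolean cases. *)
do 8! [move: (leq 1 (nth 0 s _)) => ?].
by repeat match goal with b : bool |- _ => case: b end.
Qed.

Lemma count_standard (L : seq (seq nat)) : all (fun s => size s == 16) L ->
  count standard L =
  sumn [seq count (all2 obeys (facet_constraint f)) L | f <- facets].
Proof.
have count_sum (p : seq nat -> bool) : count p L = \sum_(s <- L) p s.
  by rewrite -sum1_count big_mkcond; apply: eq_bigr => s _; case: (p s).
move=> /allP sz; rewrite count_sum sumnE big_map.
under [RHS]eq_bigr => f _ do rewrite count_sum.
rewrite exchange_big; apply: eq_big_seq => s /sz /eqP sz_s.
rewrite standard_facets // -sum1_count big_mkcond.
by apply: eq_bigr => f _; case: (all2 _ _ _).
Qed.

Definition standard_exponents d := [seq s <- exponents 16 d | standard s].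

Lemma size_standard_exponents d : size (standard_exponents d) = series_coef d.
Proof.
rewrite size_filter count_standard; last first.
  by apply/allP => s; rewrite mem_exponents => /andP[].
(* Every facet avoids five variables and so keeps 11. The number [p] of those forced positive takes
   the values 0, 1, 2, 3 with multiplicities 1, 5, 5, 1. *)
pose g p := if p <= d then 'C(d - p + 10, 10) else 0.
have -> : [seq count (all2 obeys (facet_constraint f)) (exponents 16 d) | f <- facets]
    = map g [:: 0; 1; 1; 2; 1; 2; 1; 2; 1; 2; 2; 3].
  rewrite (_ : [:: 0; 1; 1; 2; 1; 2; 1; 2; 1; 2; 2; 3] =
    [seq npos (facet_constraint f) | f <- facets]) // -map_comp.
  apply/eq_in_map => f f_facet; rewrite [LHS](_ : _ =
    count (all2 obeys (facet_constraint f)) (exponents (size (facet_constraint f)) d)); last by rewrite size_mkseq.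
  rewrite count_exponents (_ : nfree _ = 11) //.
  by apply/eqP; move: f f_facet; apply/allP.
rewrite /series_coef.
(* Coefficients beyond the third vanish; the guard [k <= d] keeps truncated subtraction from adding
   terms when [d < 3]. *)
have -> : \sum_(k < d.+1) num_coef k * 'C(d - k + 10, 10) =
          \sum_(0 <= k < 4) (if k <= d then num_coef k * 'C(d - k + 10, 10) else 0).
  rewrite -(big_mkord xpredT (fun k => num_coef k * 'C(d - k + 10, 10))).
  have [le_d4|lt_4d] := leqP d.+1 4.
    rewrite (big_cat_nat (n := d.+1) (p := 4)) //= [X in _ = _ + X]big1_seq ?addn0.
      by apply: eq_big_nat => i Hi; rewrite (_ : i <= d) //; lia.
    by move=> i; rewrite mem_index_iota => /andP[_ Hi]; case: leqP => //; lia.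
  rewrite (big_cat_nat (n := 4)) //=; last by lia.
  rewrite [X in _ + X = _]big1_seq ?addn0.
    by apply: eq_big_nat => i Hi; rewrite (_ : i <= d) //; lia.
  move=> i; rewrite mem_index_iota => /andP[_ Hi].
  by rewrite /num_coef nth_default //=; lia.
rewrite unlock /= /num_coef /= /g leq0n.
by case: (0 < d); case: (1 < d); case: (2 < d); lia.
Qed.

(** * Leading exponents on a chart *)

(* The ten variables [x_k] that are free on the chart [x_0 = 1], listed by
   increasing degree of the monomial in [t] substituted for them. *)
Definition chart_vars : seq nat := [:: 1; 4; 10; 11; 12; 14; 8; 2; 15; 3].

(* The factors of the dominant term of [spinor x k]. *)
Definition lead_factors (k : nat) : seq nat :=
  match k with
  | 0 => [::]
  | 5 => [:: 10; 15]
  | 6 => [:: 2; 4]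
  | 7 => [:: 3; 4]
  | 9 => [:: 3; 10]
  | 13 => [:: 3; 14]
  | _ => [:: k]
  end.

Lemma standard_zeros s : size s = 16 -> standard s ->
  has (fun f => all (fun k => nth 0 s k == 0) f.1) facets.
Proof.
move/seq16P=> ->.
have eq0b n : (n == 0) = ~~ (0 < n) by rewrite lt0n negbK.
rewrite /standard /= !eq0b.
do 8! [move: (leq 1 (nth 0 s _)) => ?].
by repeat match goal with b : bool |- _ => case: b end.
Qed.

(** The exponents of the chart variables in the dominant term of the product of the [spinor x k]
    raised to the entries of [s]. As x_0 = 1, entry 0 leaves no trace and must be recovered from the
    total degree. *)
Definition lead_exponents (s : seq nat) : seq nat :=
  [seq \sum_(0 <= k < 16) nth 0 s k * (j \in lead_factors k) | j <- chart_vars].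

Lemma lead_exponentsE s : lead_exponents s =
  let n := nth 0 s in
  [:: n 1; n 4 + n 6 + n 7; n 5 + n 9 + n 10; n 11; n 12; n 13 + n 14; n 8;
      n 2 + n 6; n 5 + n 15; n 3 + n 7 + n 9 + n 13].
Proof.
by rewrite /lead_exponents /= unlock /= ?(muln0, muln1, addn0, add0n, addnA).
Qed.

Lemma lead_exponents_inj s t : size s = 16 -> size t = 16 ->
    sumn s = sumn t -> standard s -> standard t ->
  lead_exponents s = lead_exponents t -> s = t.
Proof.
move=> sz_s sz_t sum_st std_s std_t; rewrite !lead_exponentsE /=.
have := standard_zeros sz_s std_s; have := standard_zeros sz_t std_t.
have := seq16P sz_s; have := seq16P sz_t.
move: (nth 0 s) (nth 0 t) => m n tE sE.
rewrite {}tE {}sE in sum_st *; rewrite /= in sum_st *.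
rewrite ?andbT ?orbF => n_zeros m_zeros [e1 e4 e10 e11 e12 e14 e8 e2 e15 e3].
(* The other nine equalities follow from these and the leading exponents. *)
suff: m 0 = n 0 /\ m 2 = n 2 /\ m 4 = n 4 /\ m 5 = n 5 /\ m 7 = n 7 /\
      m 9 = n 9 /\ m 13 = n 13.
  by move=> {n_zeros m_zeros sum_st} eqs; do 16! [congr cons; first by lia].
move: sum_st e4 e10 e14 e2 e15 e3; rewrite {}e1 {}e8 {}e11 {}e12.
move: n_zeros m_zeros.
do 12! [move: (m _) => ?]; do 16! [move: (n _) => ?] =>
  {s t sz_s sz_t std_s std_t m n}.
move=> n_zeros m_zeros.
(* One case for each pair of facets containing the two supports: five exponents vanish on each side,
   and the rest is linear arithmetic. *)
repeat (case/orP: m_zeros => m_zeros);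
  case/and5P: m_zeros => /eqP-> /eqP-> /eqP-> /eqP-> /eqP->.
all: repeat (case/orP: n_zeros => n_zeros);
  case/and5P: n_zeros => /eqP-> /eqP-> /eqP-> /eqP-> /eqP->.
all: lia.
Qed.

(** Uniqueness of base-[B] digits, least significant first. *)
Lemma radix_inj B s t : size s = size t ->
    all (gtn B) s -> all (gtn B) t ->
  foldr (fun k n => k + B * n) 0 s = foldr (fun k n => k + B * n) 0 t -> s = t.
Proof.
elim: s t => [|i s IHs] [|j t] //= [eq_sz] /andP[lt_i lt_s] /andP[lt_j lt_t].
move: (foldr _ _ s) (foldr _ _ t) (IHs t eq_sz lt_s lt_t) => x y eq_xy eq_ij.
have B0 : 0 < B by apply: leq_ltn_trans lt_i.
have eqij : i = j.
  move/(congr1 (modn^~ B)): eq_ij.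
  by rewrite -!(addnC (B * _)) ![B * _]mulnC !modnMDl !modn_small.
move/eqP: eq_ij; rewrite eqij eqn_add2l eqn_mul2l eqn0Ngt B0 /=.
by move/eqP/eq_xy->.
Qed.

(** Each entry is at most [sumn s]; the slack makes the same bound usable as a base larger than 2,
    even in degree 0. *)
Lemma lead_exponents_bound s : size s = 16 ->
  all (gtn (sumn s).+3) (lead_exponents s).
Proof.
move/seq16P=> sE; rewrite lead_exponentsE [in sumn _]sE.
by move: (nth 0 s) => n /=; lia.
Qed.

Local Open Scope ring_scope.

(** * Straightening *)

(** Allows the rest of the proof to work with multiples of symplectic matrices instead of their
    closure. *)
Lemma vanishing_closure (X : 'M[CC]_4 -> Prop) p :
  vanishing_ideal (zariski_closure X) p <-> vanishing_ideal X p.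
Proof.
split=> [van N XN | van N closN]; last exact: closN.
by apply: van => q; apply.
Qed.

Lemma mat_pt_inord (N : 'M[CC]_4) k : (k < 16)%N ->
  mat_pt N (inord k) = N (inord (k %/ 4)) (inord (k %% 4)).
Proof. by move=> lt_k; rewrite /mat_pt inordK. Qed.

Lemma big_ord4 (F : 'I_4 -> CC) :
  \sum_i F i = F (inord 0) + F (inord 1) + F (inord 2) + F (inord 3).
Proof.
rewrite !big_ord_recr big_ord0 /= add0r.
by do !congr (_ + _); congr F; apply/val_inj; rewrite /= inordK.
Qed.

Lemma tr_J_mul (N : 'M[CC]_4) i j :
  (N^T *m Jmat *m N) i j =
    N (inord 0) i * N (inord 1) j - N (inord 1) i * N (inord 0) j
    + N (inord 2) i * N (inord 3) j - N (inord 3) i * N (inord 2) j.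
Proof.
rewrite mxE big_ord4 !mxE !big_ord4 !mxE !inordK //=; ring.
Qed.

Lemma Jmat_sqr : Jmat *m Jmat = - 1%:M.
Proof.
apply/matrixP => i j; rewrite mxE big_ord4 !mxE !inordK //= -(inj_eq val_inj).
by case: i => [[|[|[|[|//]]]]] ?; case: j => [[|[|[|[|//]]]]] ? /=; ring.
Qed.

(** As J^2 = -1, the matrix - J M^T J is a left inverse of M, hence a right inverse, which gives M J
    M^T = J. *)
Lemma Sp4_tr M : Sp4 M -> Sp4 M^T.
Proof.
rewrite /Sp4 trmxK => MJM.
have: (- Jmat *m M^T *m Jmat) *m M = 1%:M.
  by rewrite -!mulmxA (mulmxA M^T) MJM mulNmx Jmat_sqr opprK.
move/mulmx1C => /(congr1 (mulmx^~ Jmat)); rewrite mul1mx => MK.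
by rewrite -[RHS]MK -!mulmxA Jmat_sqr !mulmxN mulmx1 mulNmx mulmxN opprK.
Qed.

(* [((a, b), ts)] stands for [x_a x_b = sum_((e, (c, d)) in ts) (-1)^e x_c x_d],
   where [x_(4 i + j)] is the entry in row [i] and column [j]. *)
Definition straightening : seq ((nat * nat) * seq (bool * (nat * nat))) :=
  [:: ((2, 4), [:: (false, (0, 6)); (false, (8, 14)); (true, (10, 12))]);
      ((0, 7), [:: (false, (3, 4)); (true, (8, 15)); (false, (11, 12))]);
      ((0, 13), [:: (false, (1, 12)); (true, (2, 15)); (false, (3, 14))]);
      ((0, 9), [:: (false, (1, 8)); (true, (2, 11)); (false, (3, 10))]);
      ((10, 15), [:: (false, (0, 5)); (true, (1, 4)); (false, (11, 14))]);
      ((9, 15), [:: (true, (1, 7)); (false, (3, 5)); (false, (11, 13))]);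
      ((10, 13), [:: (false, (1, 6)); (true, (2, 5)); (false, (9, 14))]);
      ((7, 10), [:: (false, (4, 9)); (true, (5, 8)); (false, (6, 11))]);
      ((4, 13), [:: (false, (5, 12)); (true, (6, 15)); (false, (7, 14))]);
      ((2, 7), [:: (false, (3, 6)); (false, (8, 13)); (true, (9, 12))])]%N.

Lemma straightening_Sp4 M q : Sp4 M -> q \in straightening ->
  let x k := mat_pt M (inord k) in
  x q.1.1 * x q.1.2 = \sum_(t <- q.2) (-1) ^+ t.1 * (x t.2.1 * x t.2.2).
Proof.
move=> SpM + x.
have colE i j := etrans (esym (tr_J_mul M (inord i) (inord j)))
   (congr1 (fun A : 'M_4 => A (inord i) (inord j)) SpM).
have rowE i j := etrans (esym (tr_J_mul M^T (inord i) (inord j)))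
   (congr1 (fun A : 'M_4 => A (inord i) (inord j)) (Sp4_tr SpM)).
have xE i j : (i < 4)%N -> (j < 4)%N -> M (inord i) (inord j) = x (4 * i + j)%N.
  move=> lt_i lt_j; rewrite /x mat_pt_inord; last by lia.
  by rewrite mulnC divnMDl // modnMDl divn_small // modn_small // addn0.
move: (colE 0 1)%N (colE 0 2)%N (colE 0 3)%N (colE 1 2)%N (colE 1 3)%N (colE 2 3)%N.
move: (rowE 0 1)%N (rowE 0 2)%N (rowE 0 3)%N (rowE 1 2)%N (rowE 1 3)%N (rowE 2 3)%N.
rewrite !mxE !inordK // !xE //=.
rewrite /muln /addn /=.
move: x {xE colE rowE} => x.
move=> r01 r02 r03 r12 r13 r23 c01 c02 c03 c12 c13 c23.
rewrite !inE.
(* Each quadric is the difference of two expressions with the same value: a row or column pairing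
   against 0, or two pairings both equal to 1. *)
have lin (E E' a b e : CC) : E = e -> E' = e -> a - b = E - E' -> a = b.
  by move=> -> -> abE; apply: subr0_eq; rewrite abE subrr.
have z0 := erefl (0 : CC).
repeat case/orP; move=> /eqP -> /=; rewrite !big_cons big_nil /= ?expr0 ?expr1.
- by apply: (lin _ _ _ _ _ z0 c02); ring.
- by apply: (lin _ _ _ _ _ c03 z0); ring.
- by apply: (lin _ _ _ _ _ r03 z0); ring.
- by apply: (lin _ _ _ _ _ r02 z0); ring.
- by apply: (lin _ _ _ _ _ r23 c01); ring.
- by apply: (lin _ _ _ _ _ c13 z0); ring.
- by apply: (lin _ _ _ _ _ z0 c12); ring.
- by apply: (lin _ _ _ _ _ z0 r12); ring.
- by apply: (lin _ _ _ _ _ r13 z0); ring.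
- by apply: (lin _ _ _ _ _ r01 c01); ring.
Qed.

Lemma straightening_cone N q : cone_set N -> q \in straightening ->
  let x k := mat_pt N (inord k) in
  x q.1.1 * x q.1.2 = \sum_(t <- q.2) (-1) ^+ t.1 * (x t.2.1 * x t.2.2).
Proof.
case=> c [M [SpM ->]] q_str x.
have xE k : x k = c * mat_pt M (inord k) by rewrite /x /mat_pt mxE.
rewrite !xE mulrACA (straightening_Sp4 SpM q_str) big_distrr /=.
by apply: eq_bigr => t _; rewrite !xE [in RHS]mulrACA [RHS]mulrCA.
Qed.

Notation vanishing := (vanishing_ideal cone_set).

Lemma vanishingD p q : vanishing p -> vanishing q -> vanishing (p + q).
Proof.
by move=> vp vq N XN; rewrite /peval mevalD [_.@[_]]vp // [_.@[_]]vq // addr0.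
Qed.

Lemma vanishingZ c p : vanishing p -> vanishing (c *: p).
Proof. by move=> vp N XN; rewrite /peval mevalZ [p.@[_]]vp // mulr0. Qed.

Lemma vanishing0 : vanishing 0.
Proof. by move=> N _; rewrite /peval meval0. Qed.

Section Spanning.
Variable (B : seq 'X_{1..16}).

Definition spanned p :=
  exists c : 'X_{1..16} -> CC, vanishing (p - \sum_(m <- B) c m *: 'X_[m]).

Lemma spanned_mod p q : vanishing (p - q) -> spanned q -> spanned p.
Proof.
move=> vpq [c vq]; exists c.
by rewrite -(subrK q p) -addrA; apply: vanishingD.
Qed.

Lemma spannedD p q : spanned p -> spanned q -> spanned (p + q).
Proof.
move=> [a va] [b vb]; exists (fun m => a m + b m).
under eq_bigr => m _ do rewrite scalerDl.
by rewrite big_split opprD addrACA; apply: vanishingD.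
Qed.

Lemma spannedZ c p : spanned p -> spanned (c *: p).
Proof.
move=> [a va]; exists (fun m => c * a m).
under eq_bigr => m _ do rewrite -scalerA.
by rewrite -scaler_sumr -scalerBr; apply: vanishingZ.
Qed.

Lemma spanned0 : spanned 0.
Proof.
exists (fun=> 0); rewrite big1 ?subr0 => [|m _]; last exact: scale0r.
exact: vanishing0.
Qed.

Lemma spanned_sum (I : eqType) (r : seq I) (F : I -> {mpoly CC[16]}) :
  (forall i, i \in r -> spanned (F i)) -> spanned (\sum_(i <- r) F i).
Proof.
elim: r => [|i r IHr] spF; first by rewrite big_nil; apply: spanned0.
rewrite big_cons; apply: spannedD; first by apply: spF; rewrite mem_head.
by apply: IHr => j rj; apply: spF; rewrite inE rj orbT.
Qed.

Lemma spanned_mem m : uniq B -> m \in B -> spanned 'X_[m].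
Proof.
move=> uB Bm; exists (fun m' => (m' == m)%:R).
rewrite (bigD1_seq m) //= eqxx scale1r big1 ?addr0 => [|m' /negbTE->].
  by rewrite subrr; apply: vanishing0.
by rewrite scale0r.
Qed.

End Spanning.

Definition exps (m : 'X_{1..16}) : seq nat := [seq m i | i <- enum 'I_16].

Lemma nth_exps m k : (k < 16)%N -> nth 0%N (exps m) k = m (inord k).
Proof.
move=> lt_k; rewrite (nth_map (inord k)) ?size_enum_ord //; congr (m _).
by apply: val_inj; rewrite /= nth_enum_ord // inordK.
Qed.

Lemma size_exps m : size (exps m) = 16.
Proof. by rewrite size_map size_enum_ord. Qed.

Lemma sumn_exps m : sumn (exps m) = mdeg m.
Proof. by rewrite mdegE sumnE big_map big_enum. Qed.

Definition mono_of (s : seq nat) : 'X_{1..16} := [multinom nth 0%N s i | i < 16].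

Lemma expsK : cancel exps mono_of.
Proof.
move=> m; apply/mnmP => i.
by rewrite mnmE nth_exps ?ltn_ord // inord_val.
Qed.

Lemma mono_ofK s : size s = 16 -> exps (mono_of s) = s.
Proof.
move=> sz_s; apply: (@eq_from_nth _ 0%N); rewrite size_exps ?sz_s // => k lt_k.
by rewrite nth_exps // mnmE inordK.
Qed.

Definition standard_monomials d := map mono_of (standard_exponents d).

Lemma mem_standard_monomials d m :
  (m \in standard_monomials d) = (mdeg m == d) && standard (exps m).
Proof.
apply/mapP/andP => [[s] | [/eqP <- std_m]]; last first.
  exists (exps m); last by rewrite expsK.
  by rewrite mem_filter std_m mem_exponents size_exps sumn_exps !eqxx.
rewrite mem_filter mem_exponents => /and3P[std_s /eqP sz_s sum_s] ->.
by rewrite -sumn_exps mono_ofK.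
Qed.

Lemma uniq_standard_monomials d : uniq (standard_monomials d).
Proof.
rewrite map_inj_in_uniq ?filter_uniq ?uniq_exponents // => s t.
rewrite !mem_filter !mem_exponents.
move=> /and3P[_ /eqP sz_s _] /and3P[_ /eqP sz_t _].
by move/(congr1 exps); rewrite !mono_ofK.
Qed.

(* Any weights making each left-hand side of [straightening] strictly heavier
   than every term on its right-hand side would do. *)
Definition weights : seq nat :=
  [:: 4; 0; 3; 1; 3; 1; 0; 4; 1; 3; 4; 0; 0; 4; 1; 3].

Definition weight (m : 'X_{1..16}) : nat := (\sum_(i < 16) nth 0 weights i * m i)%N.

Lemma weightD m1 m2 : weight (m1 + m2) = (weight m1 + weight m2)%N.
Proof.
by rewrite -big_split; apply: eq_bigr => i _; rewrite mnmDE mulnDr.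
Qed.

Lemma weightU i : weight U_(i) = nth 0%N weights i.
Proof.
rewrite /weight (bigD1 i) //= mnm1E eqxx muln1 big1 ?addn0 // => j ne_ji.
by rewrite mnm1E eq_sym (negbTE ne_ji) muln0.
Qed.

(** The weight drop makes rewriting terminate; since the two indices differ, positive exponents at
    both suffice for the product to divide a monomial. *)
Lemma straightening_bound q : q \in straightening ->
  [/\ (q.1.1 < 16)%N, (q.1.2 < 16)%N, q.1.1 != q.1.2 &
   forall t, t \in q.2 -> [/\ (t.2.1 < 16)%N, (t.2.2 < 16)%N &
    (nth 0 weights t.2.1 + nth 0 weights t.2.2
      < nth 0 weights q.1.1 + nth 0 weights q.1.2)%N]].
Proof.
rewrite !inE; repeat case/orP; move=> /eqP ->; split=> // t;
  by rewrite !inE => /or3P[] /eqP ->.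
Qed.

Lemma nonstandard_straightening s : ~~ standard s ->
  exists2 q, q \in straightening & (0 < nth 0 s q.1.1)%N && (0 < nth 0 s q.1.2)%N.
Proof.
have -> : standard s = ~~ has (fun q => (0 < nth 0 s q.1.1)%N && (0 < nth 0 s q.1.2)%N)
    straightening.
  rewrite -all_predC /standard (_ : forbidden_pairs = map fst straightening) //.
  by rewrite all_map; apply: eq_all => q /=; rewrite negb_and -!eqn0Ngt.
by rewrite negbK => /hasP.
Qed.

(** Induction on the weight: straightening a nonstandard monomial keeps the degree and lowers the
    weight. *)
Lemma spanned_monomial d m : mdeg m = d -> spanned (standard_monomials d) 'X_[m].
Proof.
have [n] := ubnP (weight m); elim: n m => // n IHn m lt_mn deg_m.
have [std_m|] := boolP (standard (exps m)).
  apply: spanned_mem; first exact: uniq_standard_monomials.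
  by rewrite mem_standard_monomials deg_m eqxx.
case/nonstandard_straightening=> q q_str /andP[].
have [lt_a lt_b ne_ab bnd] := straightening_bound q_str.
rewrite !nth_exps // => m_a m_b.
pose U k : 'X_{1..16} := U_(inord k)%MM.
pose m' := (m - U q.1.1 - U q.1.2)%MM.
have mE : m = (U q.1.1 + U q.1.2 + m')%MM.
  apply/mnmP => i; rewrite !mnmDE !mnmBE !mnm1E.
  have ne_U : inord q.1.1 != inord q.1.2 :> 'I_16 by rewrite -val_eqE /= !inordK.
  have [<-|_] := eqVneq (inord q.1.1) i.
    by rewrite eq_sym (negbTE ne_U); lia.
  by have [<-|_] := eqVneq (inord q.1.2) i; lia.
pose t_mono (t : bool * (nat * nat)) := (U t.2.1 + U t.2.2 + m')%MM.
apply: (@spanned_mod _ _ (\sum_(t <- q.2) (-1) ^+ t.1 *: 'X_[t_mono t])).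
  move=> N XN; rewrite /peval mevalB {1}mE (big_morph _ (mevalD _) (meval0 _)).
  under eq_bigr => t _ do rewrite mevalZ !mpolyXD !mevalM !mevalXU mulrA.
  by rewrite -mulr_suml -(straightening_cone XN q_str) !mpolyXD !mevalM !mevalXU subrr.
apply: spanned_sum => t /bnd [lt_c lt_d wt_t]; apply: spannedZ; apply: IHn.
  move: lt_mn; rewrite mE /t_mono !weightD !weightU !inordK // ltnS.
  by apply: leq_trans; rewrite ltn_add2r.
by rewrite -deg_m mE /t_mono !mdegD !mdeg1.
Qed.

Lemma spanned_homog d p : homog_deg d p -> spanned (standard_monomials d) p.
Proof.
move=> /allP hom_p; rewrite [p]mpolyE; apply: spanned_sum => m /hom_p /eqP deg_m.
by apply: spannedZ; apply: spanned_monomial.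
Qed.

Lemma dependent_of_spanned (B : seq 'X_{1..16}) (n := size B)
    (fs : 'I_n.+1 -> {mpoly CC[16]}) :
  (forall i, spanned B (fs i)) -> ~ indep_mod vanishing fs.
Proof.
move=> spf ind.
have /fin_all_exists [c vc] i : exists c : 'I_n -> CC,
    vanishing (fs i - \sum_j c j *: 'X_[nth 0%MM B j]).
  have [a va] := spf i; exists (fun j => a (nth 0%MM B j)).
  by move: va; rewrite (big_nth 0%MM) big_mkord.
pose A : 'M[CC]_(n.+1, n) := \matrix_(i, j) c i j.
have kerA : kermx A != 0.
  rewrite kermx_eq0 /row_free neq_ltn; apply/orP; left.
  by rewrite ltnS rank_leq_col.
pose a := nz_row (kermx A).
have aA : a *m A = 0 by apply/sub_kermxP; apply: nz_row_sub.
have /eqP [] : a != 0 by rewrite nz_row_eq0.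
apply/rowP => i; rewrite mxE; move: i; apply: ind.
(* Since [a] is in the left kernel of [A], the subtracted combinations of monomials cancel, and only
   elements of the ideal remain. *)
have -> : \sum_i a 0 i *: fs i =
    \sum_i a 0 i *: (fs i - \sum_j c i j *: 'X_[nth 0%MM B j]).
  under [RHS]eq_bigr => i _ do rewrite scalerBr scaler_sumr.
  rewrite sumrB exchange_big /= [X in _ - X]big1 ?subr0 // => j _.
  under eq_bigr => i _ do rewrite scalerA.
  have sum0 : \sum_i a 0 i * c i j = 0.
    transitivity ((a *m A) 0 j); last by rewrite aA mxE.
    by rewrite mxE; apply: eq_bigr => i _; rewrite mxE.
  by rewrite -scaler_suml sum0 scale0r.
elim/big_rec: _ => [|i p _ vp]; first exact: vanishing0.
by apply: vanishingD vp; apply: vanishingZ.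
Qed.

(** * Linear independence *)

(* Entry [k = 4 i + j] of the point with coordinates [x] on the chart [x_0 = 1];
   the entries 5, 6, 7, 9 and 13 are solved for. *)
Definition spinor (A : comNzRingType) (x : nat -> A) (k : nat) : A :=
  match k with
  | 0%N => 1
  | 5%N => x 10%N * x 15%N + (x 1%N * x 4%N - x 11%N * x 14%N)
  | 6%N => x 2%N * x 4%N + (x 10%N * x 12%N - x 8%N * x 14%N)
  | 7%N => x 3%N * x 4%N + (x 11%N * x 12%N - x 8%N * x 15%N)
  | 9%N => x 3%N * x 10%N + (x 1%N * x 8%N - x 2%N * x 11%N)
  | 13%N => x 3%N * x 14%N + (x 1%N * x 12%N - x 2%N * x 15%N)
  | _ => x k
  end.

(* [M^T J M = multiplier x *: J] for the matrix [M = chart x] below. *)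
Definition multiplier (A : comNzRingType) (x : nat -> A) : A :=
  x 8%N * spinor x 13%N + (x 10%N * x 15%N - x 11%N * x 14%N - x 12%N * spinor x 9%N).

Definition chart (x : nat -> CC) : 'M[CC]_4 := \matrix_(i, j) spinor x (4 * i + j).

Lemma mat_pt_chart x k : mat_pt (chart x) k = spinor x k.
Proof.
rewrite /mat_pt mxE !inordK ?ltn_mod //; last by rewrite ltn_divLR // ltn_ord.
by rewrite mulnC -divn_eq.
Qed.

Lemma chart_similitude x :
  (chart x)^T *m Jmat *m chart x = multiplier x *: Jmat.
Proof.
apply/matrixP => i j; rewrite tr_J_mul !mxE !inordK // /multiplier.
by case: i => [[|[|[|[|//]]]]] ?; case: j => [[|[|[|[|//]]]]] ? /=; ring.
Qed.

(** Dividing by a square root of the multiplier gives a symplectic matrix. *)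
Lemma chart_cone x : multiplier x != 0 -> cone_set (chart x).
Proof.
move=> x_n0; pose s := sqrtC (multiplier x).
have s2 : s ^+ 2 = multiplier x by rewrite sqrtCK.
have s_n0 : s != 0 by rewrite sqrtC_eq0.
exists s, (s^-1 *: chart x); split; last by rewrite scalerA divff // scale1r.
rewrite /Sp4 -scalemxAr [(_ *: _)^T]linearZ /= -!scalemxAl chart_similitude.
rewrite !scalerA -s2 [_ * s ^+ 2](_ : _ = (s^-1 * s) ^+ 2); last by ring.
by rewrite mulVf // expr1n scale1r.
Qed.

Lemma horner_spinor (X : nat -> {poly CC}) t k :
  (spinor X k).[t] = spinor (fun k => (X k).[t]) k.
Proof.
by do 14! [case: k => [|k]; first by rewrite /= ?hornerE].
Qed.

Lemma horner_multiplier (X : nat -> {poly CC}) t :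
  (multiplier X).[t] = multiplier (fun k => (X k).[t]).
Proof. by rewrite /multiplier /= !hornerE. Qed.

Lemma poly_vanishing (p : {poly CC}) : (forall t, p.[t] = 0) -> p = 0.
Proof.
move=> p0; apply: (@roots_geq_poly_eq0 _ _ [seq k%:R | k <- iota 0 (size p)]).
- by apply/allP => t _; rewrite /root p0.
- by rewrite map_inj_uniq ?iota_uniq // => i j /eqP; rewrite eqr_nat => /eqP.
- by rewrite size_map size_iota.
Qed.

(** Among the terms with nonzero coefficient, the one of largest degree has a leading term that
    nothing can cancel. *)
Lemma distinct_sizes_indep (I : finType) (p : I -> {poly CC}) (a : I -> CC) :
    injective (size \o p) -> (forall i, p i != 0) ->
  \sum_i a i *: p i = 0 -> forall i, a i = 0.
Proof.
move=> inj_p p_n0 sum0 i0; apply/eqP/negPn/negP => a_i0.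
case: (@arg_maxnP _ i0 (fun i => a i != 0) (size \o p) a_i0) => i a_i max_i.
move/(congr1 (fun q : {poly CC} => q`_(size (p i)).-1)): sum0.
rewrite coef0 coef_sum (bigD1 i) //= big1 => [|j ne_ji].
  rewrite addr0 coefZ => /eqP.
  by rewrite mulf_eq0 (negbTE a_i) lead_coef_eq0 (negbTE (p_n0 i)).
rewrite coefZ; have [->|a_j] := eqVneq (a j) 0; first by rewrite mul0r.
rewrite nth_default ?mulr0 //.
have : (size (p j) != size (p i))%N by apply: contraNneq ne_ji => /inj_p ->.
rewrite -ltnS prednK ?size_poly_gt0 // ltn_neqAle.
  by move=> ->; apply: max_i.
Qed.

Section Degrees.
Variable B : nat.
Hypothesis B3 : (2 < B)%N.

(** Kronecker substitution: exponents below [B] become the base-[B] digits of the degree. *)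
Definition chart_var (k : nat) : {poly CC} := 'X^(B ^ index k chart_vars).

Definition lead_degree (k : nat) : nat :=
  \sum_(j <- lead_factors k) B ^ index j chart_vars.

Lemma size_XnD n (p : {poly CC}) : (size p <= n)%N -> size ('X^n + p) = n.+1.
Proof. by move=> le_pn; rewrite size_polyDl size_polyXn. Qed.

Lemma size_XnB_le m n r : (m < r)%N -> (n < r)%N ->
  (size ('X^m - 'X^n : {poly CC})%R <= r)%N.
Proof.
move=> lt_mr lt_nr; apply: leq_trans (size_polyD _ _) _.
by rewrite size_polyN !size_polyXn geq_max lt_mr.
Qed.

Lemma pow_bounds i : (3 * B ^ i <= B ^ i.+1)%N.
Proof. by rewrite expnS leq_mul2r B3 orbT. Qed.

(** The first term of each quadratic entry has a variable later in [chart_vars] than all those in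
    its other terms, and two smaller powers of [B] sum to less than the next power. *)
Lemma size_spinor k : (k < 16)%N -> size (spinor chart_var k) = (lead_degree k).+1.
Proof.
move=> lt_k.
move: (pow_bounds 0) (pow_bounds 1) (pow_bounds 2) (pow_bounds 3) (pow_bounds 4)
  (pow_bounds 5) (pow_bounds 6) (pow_bounds 7) (pow_bounds 8) (expn0 B) => *.
move: lt_k; do 16! [case: k => [|k]; first by rewrite /lead_degree /= ?big_cons big_nil ?addn0
  ?size_poly1 // /chart_var -?exprD; do ?[rewrite size_XnD ?size_XnB_le ?addn0 //];
  rewrite ?size_polyXn //=; lia].
by [].
Qed.

Lemma multiplier_n0 : multiplier chart_var != 0.
Proof.
move: (pow_bounds 0) (pow_bounds 1) (pow_bounds 2) (pow_bounds 3) (pow_bounds 4)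
  (pow_bounds 5) (pow_bounds 6) (pow_bounds 7) (pow_bounds 8) (expn0 B) => *.
have sz k : (k < 16)%N -> size (spinor chart_var k) = (lead_degree k).+1.
  exact: size_spinor.
have sz13 := sz 13%N isT; have sz9 := sz 9%N isT; have sz8 := sz 8%N isT.
have sz12 := sz 12%N isT.
have sz_mul (p q : {poly CC}) m n : size p = m.+1 -> size q = n.+1 ->
    size (p * q) = (m + n).+1.
  move=> sp sq; rewrite size_mul ?sp ?sq ?addnS //;
    by rewrite -size_poly_gt0 ?sp ?sq.
(* The term x_3 x_8 x_14 of the first product dominates all others, in particular x_3 x_10 x_12. *)
rewrite -size_poly_gt0 /multiplier size_polyDl (sz_mul _ _ _ _ sz8 sz13) //.
apply: leq_ltn_trans (size_polyD _ _) _.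
rewrite size_polyN (sz_mul _ _ _ _ sz12 sz9) gtn_max; apply/andP; split.
  rewrite ltnS /chart_var -!exprD; apply: size_XnB_le;
  rewrite /lead_degree /= ?big_cons big_nil /=; lia.
rewrite /lead_degree /= ?big_cons big_nil /=; lia.
Qed.

End Degrees.

Section Chart.
Variable B : nat.
Hypothesis B3 : (2 < B)%N.

Definition chart_monomial (m : 'X_{1..16}) : {poly CC} :=
  \prod_(k < 16) spinor (chart_var B) k ^+ m k.

Lemma size_chart_monomial m : size (chart_monomial m) =
  (foldr (fun k n => k + B * n) 0 (lead_exponents (exps m))).+1%N.
Proof.
transitivity (\sum_(k < 16) lead_degree B k * m k).+1%N.
  rewrite /chart_monomial.
  elim/big_rec2: _ => [|k n p _ szp]; first by rewrite size_poly1.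
  have sz_k := size_spinor B3 (ltn_ord k).
  have k_n0 : spinor (chart_var B) k ^+ m k != 0.
    by rewrite expf_neq0 // -size_poly_gt0 sz_k.
  have p_n0 : p != 0 by rewrite -size_poly_gt0 szp.
  have <- : (size (spinor (chart_var B) k ^+ m k)).-1 = (lead_degree B k * m k)%N.
    by rewrite size_exp sz_k.
  by rewrite size_mul // szp addnS /= -addSn prednK // size_poly_gt0.
congr _.+1; under eq_bigr => k _ do rewrite -{2}[k]inord_val -nth_exps //.
rewrite -(big_mkord xpredT (fun k => lead_degree B k * nth 0 (exps m) k)%N).
rewrite lead_exponentsE; move: (nth 0 (exps m)) => n.
rewrite unlock /= /lead_degree unlock /=; ring.
Qed.

Lemma horner_chart_monomial m t :
  (chart_monomial m).[t] =
  ('X_[m]).@[mat_pt (chart (fun k => (chart_var B k).[t]))].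
Proof.
rewrite mevalX horner_prod; apply: eq_bigr => k _.
by rewrite horner_exp horner_spinor mat_pt_chart.
Qed.

(** Chart points are known to lie on the cone only where the multiplier is nonzero; multiplying by
    it gives a polynomial vanishing everywhere, and this nonzero factor then cancels. *)
Lemma vanishing_chart (I : finType) (m : I -> 'X_{1..16}) (a : I -> CC) :
  vanishing (\sum_i a i *: 'X_[m i]) -> \sum_i a i *: chart_monomial (m i) = 0.
Proof.
move=> van; apply/eqP.
suff /eqP : (\sum_i a i *: chart_monomial (m i)) * multiplier (chart_var B) = 0.
  by rewrite mulf_eq0 (negbTE (multiplier_n0 B3)) orbF.
apply: poly_vanishing => t; pose x k := (chart_var B k).[t].
rewrite hornerM horner_multiplier -/x.
have [->|/chart_cone /van] := eqVneq (multiplier x) 0; first by rewrite mulr0.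
rewrite /peval (big_morph _ (mevalD _) (meval0 _)) horner_sum => van_t.
rewrite (eq_bigr (fun i => (a i *: 'X_[m i]).@[mat_pt (chart x)])) ?van_t ?mul0r //.
by move=> i _; rewrite mevalZ hornerZ horner_chart_monomial.
Qed.

End Chart.

Lemma standard_monomials_indep d (B := standard_monomials d) (n := size B) :
  indep_mod vanishing (fun i : 'I_n => 'X_[nth 0%MM B i] : {mpoly CC[16]}).
Proof.
move=> a /(@vanishing_chart d.+3 isT).
apply: distinct_sizes_indep => [i j|i]; last first.
  by rewrite -size_poly_gt0 size_chart_monomial.
have memB k : (mdeg (nth 0%MM B (k : 'I_n)) = d) * standard (exps (nth 0%MM B k)).
  have : nth 0%MM B k \in B by rewrite mem_nth.
  by rewrite mem_standard_monomials => /andP[/eqP].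
have bound k : all (gtn d.+3) (lead_exponents (exps (nth 0%MM B (k : 'I_n)))).
  by have := lead_exponents_bound (size_exps (nth 0%MM B k)); rewrite sumn_exps memB.
(* Equal sizes give equal numbers in base [d.+3], hence equal leading exponents, hence equal
   standard monomials. *)
rewrite /comp !size_chart_monomial // => /succn_inj.
move/radix_inj => /(_ _ (bound i) (bound j)); rewrite !size_map => /(_ erefl).
move/lead_exponents_inj; rewrite !size_exps !sumn_exps !memB.
move=> /(_ erefl erefl erefl isT isT) /(can_inj expsK) /eqP.
by rewrite nth_uniq ?uniq_standard_monomials // => /eqP /val_inj.
Qed.

(* The Hilbert series of O(C(Sp(4))) equals (1+5t+5t^2+t^3)/(1-t)^11,
   stated coefficientwise: for every degree d, dim_C of the degree-d
   component of C[x_ij]/I(C(Sp(4))) is the t^d coefficient of that series. *)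
Theorem theorem3p6 :
  forall d : nat, graded_dim_eq (vanishing_ideal cone_Sp4) d (series_coef d).
Proof.
move=> d.
have indepE k (fs : 'I_k -> {mpoly CC[16]}) :
    indep_mod (vanishing_ideal cone_Sp4) fs <-> indep_mod vanishing fs.
  by split=> ind a /vanishing_closure; apply: ind.
have <- : size (standard_monomials d) = series_coef d.
  by rewrite size_map size_standard_exponents.
split=> [|fs hom_fs /indepE]; last first.
  by apply: dependent_of_spanned => i; apply: spanned_homog.
exists (fun i => 'X_[nth 0%MM (standard_monomials d) i]); split=> [i|].
  apply/allP => m; rewrite msuppX inE => /eqP ->.
  have : nth 0%MM (standard_monomials d) i \in standard_monomials d by rewrite mem_nth.
  by rewrite mem_standard_monomials => /andP[].
by apply/indepE; apply: standard_monomials_indep.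
Qed.
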